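(* Let $m,n,d,e,k$ be positive integers with $m=2n$, $e=\gcd(n,d)=\gcd(m,d)$ and $1\le k\le\frac{n}{e}$, with $C$, ${\rm DC}$ and $B_{\vec a}$ as in the context. For even $r$ with $0\le r\le m/e$ and $\varepsilon\in\{1,-1\}$, let $\alpha_{r,\varepsilon}=\#\{0\ne c\in C\mid {\rm DC}(c)=-1+\varepsilon2^{m-\frac{er}{2}}\}$ and \[\beta_r=2^{-m}\#\{\vec a\in\mathbb{F}_{2^n}\times\mathbb{F}_{2^m}^k\mid {\rm rk}(B_{\vec a})=r,\ (a_0,a_1,\dots,a_{k-1})\ne0\}.\] Then for each even $r$ with $0\le r\le m/e$ and each $\varepsilon=\pm1$, \[\alpha_{r,\varepsilon}=\frac12\big(2^{er}+\varepsilon2^{\frac{er}{2}}\big)\beta_r.\]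
   Context: For $\vec a=(a_0,\dots,a_k)\in\mathbb{F}_{2^n}\times\mathbb{F}_{2^m}^k$ define $Q_{\vec a}:\mathbb{F}_{2^m}\to\mathbb{F}_{2^e}$ by \[Q_{\vec a}(x)={\rm Tr}_{\mathbb{F}_{2^n}/\mathbb{F}_{2^e}}\big(a_0x^{2^{nd/e}+1}\big)+\sum_{j=1}^{k-1}{\rm Tr}_{\mathbb{F}_{2^m}/\mathbb{F}_{2^e}}\big(a_jx^{2^{(\frac{n}{e}-j)d}+1}\big)+{\rm Tr}_{\mathbb{F}_{2^m}/\mathbb{F}_{2^e}}(a_kx).\] Here $x^{2^{nd/e}+1}\in\mathbb{F}_{2^n}$. Let $B_{\vec a}(x,y)=Q_{\vec a}(x+y)-Q_{\vec a}(x)-Q_{\vec a}(y)$, an $\mathbb{F}_{2^e}$-bilinear form on the $\mathbb{F}_{2^e}$-space $\mathbb{F}_{2^m}$. Its rank ${\rm rk}(B_{\vec a})$ is $m/e$ minus the $\mathbb{F}_{2^e}$-dimension of its radical. Let $\pi$ be a primitive element of $\mathbb{F}_{2^m}$, let $c_{\vec a}=(c_{\vec a,0},\dots,c_{\vec a,2^m-2})$ with $c_{\vec a,i}={\rm Tr}_{\mathbb{F}_{2^e}/\mathbb{F}_2}(Q_{\vec a}(\pi^{-i}))$, and let $C=\{c_{\vec a}\}$. For $c=(c_0,\dots,c_{2^m-2})\in C$, ${\rm DC}(c)=\sum_{i=0}^{2^m-2}(-1)^{c_i}$. *)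

(* Defs.v *)
From HB Require Import structures.
From mathcomp Require Import all_boot all_order all_algebra all_field.
Set Implicit Arguments. Unset Strict Implicit. Unset Printing Implicit Defensive.
Import GRing.Theory.
Local Open Scope ring_scope.

(* Setting: L is a finite field with #|L| = 2^m (so L = F_{2^m}, char 2).
   For s | m, the subfield F_{2^s} of L is {x | x^(2^s) = x}.  *)

Definition inSub (L : finFieldType) (s : nat) (x : L) : bool :=
  x ^+ (2 ^ s) == x.

(* relative trace Tr_{F_{2^{s t}} / F_{2^s}} (y) = sum_{i < t} y^(2^(s i)) *)
Definition trc (L : finFieldType) (t s : nat) (y : L) : L :=
  \sum_(i < t) y ^+ (2 ^ (s * i)).

Definition Qf (L : finFieldType) (m n d e k : nat) (a : {ffun 'I_k.+1 -> L})
    (x : L) : L :=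
  trc (n %/ e) e (a ord0 * x ^+ (2 ^ (n * d %/ e) + 1))
  + \sum_(1 <= j < k) trc (m %/ e) e (a (inord j) * x ^+ (2 ^ ((n %/ e - j) * d) + 1))
  + trc (m %/ e) e (a ord_max * x).

Definition Bf (L : finFieldType) (m n d e k : nat) (a : {ffun 'I_k.+1 -> L})
    (x y : L) : L :=
  Qf m n d e a (x + y) - Qf m n d e a x - Qf m n d e a y.

Definition radical (L : finFieldType) (m n d e k : nat) (a : {ffun 'I_k.+1 -> L})
    : {set L} :=
  [set x : L | [forall y : L, Bf m n d e a x y == 0]].

(* rank = m/e - dim_{F_{2^e}}(radical); the F_{2^e}-dimension of the finite
   F_{2^e}-space rad is log_{2^e} #|rad|. *)
Definition rk (L : finFieldType) (m n d e k : nat) (a : {ffun 'I_k.+1 -> L}) : nat :=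
  (m %/ e - trunc_log (2 ^ e) #|radical m n d e a|)%N.

Definition dom (L : finFieldType) (n k : nat) : {set {ffun 'I_k.+1 -> L}} :=
  [set a : {ffun 'I_k.+1 -> L} | inSub n (a ord0)].

Definition cw (L : finFieldType) (m n d e k : nat) (pi : L)
    (a : {ffun 'I_k.+1 -> L}) : {ffun 'I_(2 ^ m - 1) -> L} :=
  [ffun i : 'I_(2 ^ m - 1) => trc e 1 (Qf m n d e a (pi ^- i))].

Definition Code (L : finFieldType) (m n d e k : nat) (pi : L)
    : {set {ffun 'I_(2 ^ m - 1) -> L}} :=
  [set cw m n d e pi a | a in dom L n k].

(* (-1)^c for c in F_2 (viewed inside L) *)
Definition sgnF2 (L : finFieldType) (c : L) : int := if c == 0 then 1 else -1.

Definition DC (L : finFieldType) (N : nat) (c : {ffun 'I_N -> L}) : int :=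
  \sum_(i < N) sgnF2 (c i).

Definition alpha (L : finFieldType) (m n d e k : nat) (pi : L) (r : nat) (eps : int)
    : nat :=
  #|[set c in Code m n d e k pi |
       (c != [ffun => 0]) && (DC c == -1 + eps * 2 ^+ (m - e * r./2)%N)]|.

(* 2^m * beta_r *)
Definition beta_num (L : finFieldType) (m n d e k : nat) (r : nat) : nat :=
  #|[set a in dom L n k |
       (rk m n d e a == r) && [exists j : 'I_k.+1, (j < k)%N && (a j != 0)]]|.

(* Main.v *)
Require Import Defs.
From HB Require Import structures.
From mathcomp Require Import all_boot all_order all_algebra all_field.
From mathcomp Require Import zify ring.
Import GRing.Theory.
Local Open Scope ring_scope.

(* The polarization of Q_a is B_a(x, y) = Tr(y l_a(x)) for a linearized polynomial
   l_a in which a_k does not occur, so the radical is the kernel of l_a. The power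
   maps x |-> x^(2^i), 0 <= i < m, are linearly independent, so l_a vanishes only
   if a_0 = ... = a_(k-1) = 0; hence a |-> c_a is injective. Now DC(c_a) + 1 is the
   sum S(a) of (-1)^(Tr(Q_a(x))) over all x, and S(a)^2 is 0 or
   2^m |rad B_a| = 2^(2m - e rk B_a). Translating a_k by t turns S(a) into the
   Fourier transform of x |-> (-1)^(Tr(Q_a(x))) at t; summed over t, it gives 2^m,
   and its square gives 2^(2m) by Parseval. When S takes values in {0, P, -P} one
   has 2 P^2 [S = eps P] = S^2 + eps P S, so these two moments determine how often
   S takes each value as a_k varies. *)

(** * Multiplicative and quadratic sums *)

Section CharacterSums.

Variable V : finZmodType.

(** Translation by some [w] in [W] permutes [W] and multiplies the sum by [h w], so the sum vanishes
    as soon as one value [h w] differs from 1. *)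
Lemma sum_multiplicative (W : {set V}) (h : V -> int) :
    {in W &, forall x y, x - y \in W} ->
    {in W &, forall x y, h (x + y) = h x * h y} ->
  \sum_(x in W) h x = if [forall x in W, h x == 1] then #|W|%:R else 0.
Proof.
move=> WB hM; case: ifP => [/forall_inP h1 | /negbT /forall_inPn[w Ww hw1]].
  rewrite (eq_bigr (fun=> 1)) => [|x /h1 /eqP //].
  by rewrite sumr_const.
have W0 : 0 \in W by rewrite -(subrr w) WB.
have WD x : (x + w \in W) = (x \in W).
  apply/idP/idP=> Wx; first by rewrite -[x](addrK w) WB.
  by rewrite -[w]opprK WB // -[- w]add0r WB.
have : \sum_(x in W) h x = h w * \sum_(x in W) h x.
  rewrite {1}(reindex_inj (addIr w)) /= (eq_bigl _ _ WD) mulr_sumr.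
  by apply: eq_bigr => x Wx; rewrite hM // mulrC.
move/eqP; rewrite -subr_eq0 -{1}[\sum_(_ in _) _]mul1r -mulrBl mulf_eq0.
by rewrite subr_eq0 eq_sym (negPf hw1) => /eqP.
Qed.

(** Expanding the square over pairs [(x, x + y)] leaves the sum over [y] of [f y] times the
    character sum of [g x y] over [x], which is [#|V|] for [y] in [W] and 0 otherwise. On [W] the
    factor [g] is 1, so [f] is multiplicative there and its sum is 0 or [#|W|]. *)
Lemma sqr_quadratic_sum (f : V -> int) (g : V -> V -> int) :
    (forall x, f x ^+ 2 = 1) ->
    (forall x y, f (x + y) = f x * f y * g x y) ->
    (forall x x' y, g (x + x') y = g x y * g x' y) ->
    (forall x y y', g x (y + y') = g x y * g x y') ->
  let W := [set y | [forall x, g x y == 1]] in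
  (\sum_x f x) ^+ 2 = 0 \/ (\sum_x f x) ^+ 2 = #|V|%:R * #|W|%:R.
Proof.
move=> f2 fD gDl gDr W.
have inner y : \sum_x g x y = if y \in W then #|V|%:R else 0.
  rewrite inE -cardsT; have := sum_multiplicative [set: V] (g^~ y).
  rewrite (eq_bigl xpredT) => [|x]; last by rewrite inE.
  have -> : [forall x in [set: V], g x y == 1] = [forall x, g x y == 1].
    by apply: eq_forallb => x; rewrite inE.
  by apply=> x *; rewrite ?inE ?gDl.
have -> : (\sum_x f x) ^+ 2 = #|V|%:R * \sum_(y in W) f y.
  rewrite expr2 big_distrl /= mulr_sumr.
  under eq_bigr => x _.
    rewrite (reindex_inj (addrI x)) /= mulr_sumr.
    under eq_bigr => y _ do
      rewrite fD mulrA [f x * _]mulrA -expr2 f2 mul1r.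
    over.
  rewrite exchange_big [RHS]big_mkcond; apply: eq_bigr => y _ /=.
  by rewrite -mulr_sumr inner; case: ifP; rewrite ?mulr0 // mulrC.
rewrite (@sum_multiplicative W f).
- by case: ifP => _; [right | left; rewrite mulr0].
- move=> y y'; rewrite !inE => /forallP gy /forallP gy'; apply/forallP => x.
  by have := gDr x (y - y') y'; rewrite subrK (eqP (gy x)) (eqP (gy' x)) mulr1 => <-.
- by move=> y y' _; rewrite inE fD => /forallP/(_ y)/eqP->; rewrite mulr1.
Qed.

End CharacterSums.

Lemma count_three_valued (T : finType) (S : T -> int) (P A eps : int) :
    eps ^+ 2 = 1 ->
    (forall t, S t = 0 \/ S t ^+ 2 = P ^+ 2) ->
    \sum_t S t = A -> \sum_t S t ^+ 2 = A ^+ 2 ->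
  2 * P ^+ 2 * #|[set t | S t == eps * P]|%:R = A ^+ 2 + eps * P * A.
Proof.
move=> eps2 S3 sumS sumS2.
(* From here the identity is checked for each [t]: the two terms on the right cancel when [S t] is
   [- eps * P]. *)
rewrite -{1}sumS2 -sumS mulr_sumr -big_split -sum1dep_card natr_sum mulr_sumr.
rewrite big_mkcond; apply: eq_bigr => t _.
rewrite -[RHS]/(S t ^+ 2 + eps * P * S t).
have [-> | nSt] := eqVneq (S t) (eps * P).
  by transitivity (eps ^+ 2 * (2 * P ^+ 2)); [rewrite eps2; ring | ring].
case: (S3 t) => [-> | St2]; first by ring.
have/eqP : S t ^+ 2 = (eps * P) ^+ 2 by rewrite exprMn eps2 mul1r.
rewrite eqf_sqr (negPf nSt) => /eqP ->.
by ring.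
Qed.

(** * Traces and additive characters in characteristic 2 *)

Section FiniteFieldOfChar2.

Variables (L : finFieldType) (m : nat).
Hypothesis cardL : #|L| = (2 ^ m)%N.

Lemma pchar2 : 2 \in [pchar L].
Proof. exact: card_finPcharP cardL isT. Qed.

Lemma card_exp_gt0 : (0 < m)%N.
Proof. by rewrite -(ltn_exp2l 0 m (isT : 1 < 2)%N) -cardL finNzRing_gt1. Qed.

Lemma frobD i (x y : L) : (x + y) ^+ (2 ^ i) = x ^+ (2 ^ i) + y ^+ (2 ^ i).
Proof.
by rewrite exprDn_pchar // pnatX pnatE // pchar2.
Qed.

Lemma frob0 i : (0 : L) ^+ (2 ^ i) = 0.
Proof. by rewrite expr0n expn_eq0. Qed.

Lemma frob_sum (I : Type) (r : seq I) (P : pred I) (F : I -> L) i :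
  (\sum_(j <- r | P j) F j) ^+ (2 ^ i) = \sum_(j <- r | P j) F j ^+ (2 ^ i).
Proof. exact: (big_morph _ (frobD i) (frob0 i)). Qed.

Lemma frob_comp i j (x : L) : (x ^+ (2 ^ i)) ^+ (2 ^ j) = x ^+ (2 ^ (i + j)).
Proof. by rewrite -exprM -expnD. Qed.

Lemma frob_mul_fix t i (x : L) : x ^+ (2 ^ t) = x -> x ^+ (2 ^ (t * i)) = x.
Proof.
by move=> fix_x; elim: i => [|i IH]; rewrite ?muln0 ?expr1 // mulnS -frob_comp fix_x.
Qed.

Lemma frob_dvd_fix t i (x : L) :
  (t %| i)%N -> x ^+ (2 ^ t) = x -> x ^+ (2 ^ i) = x.
Proof. by move/dvdnP=> [q ->] fix_x; rewrite mulnC frob_mul_fix. Qed.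

Lemma frob_full i (x : L) : (m %| i)%N -> x ^+ (2 ^ i) = x.
Proof. by move/frob_dvd_fix; apply; rewrite -cardL expf_card. Qed.

Lemma frob_mod i (x : L) : x ^+ (2 ^ (i %% m)) = x ^+ (2 ^ i).
Proof.
by rewrite [in RHS](divn_eq i m) -frob_comp [in RHS](@frob_full (_ * m)) ?dvdn_mull.
Qed.

(** With exponents reduced modulo [m], the sum is a polynomial of degree below [2 ^ m] with all of
    [L] as roots, hence zero. Distinct residues keep the monomials apart, so each [c i] is one of
    its coefficients. *)
Lemma linearized_free (I : finType) (s : I -> nat) (c : I -> L) :
    (forall i j, s i = s j %[mod m] -> i = j) ->
    (forall x, \sum_i c i * x ^+ (2 ^ s i) = 0) ->
  forall i, c i = 0.
Proof.
move=> s_inj vanish i.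
have m_gt0 := card_exp_gt0.
pose p : {poly L} := \sum_i c i *: 'X^(2 ^ (s i %% m)).
have p0 : p = 0.
  apply: (@roots_geq_poly_eq0 _ _ (enum L)); last 2 first.
  - exact: enum_uniq.
  - rewrite -cardE cardL (leq_trans (size_sum _ _ _)) //.
    apply/bigmax_leqP => j _; rewrite (leq_trans (size_scale_leq _ _)) //.
    by rewrite size_polyXn ltn_exp2l // ltn_mod.
  apply/allP => x _; rewrite /root /p horner_sum; apply/eqP.
  by rewrite -[RHS](vanish x); apply: eq_bigr => j _; rewrite !hornerE frob_mod.
have := coef0 L (2 ^ (s i %% m)); rewrite -p0 coef_sum (bigD1 i) //= big1.
  by rewrite addr0 coefZ coefXn eqxx mulr1.
move=> j ji; rewrite coefZ coefXn eqn_exp2l //; case: eqP => [/s_inj ij | _].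
  by rewrite ij eqxx in ji.
by rewrite mulr0.
Qed.

Lemma trcD t s (x y : L) : trc t s (x + y) = trc t s x + trc t s y.
Proof. by rewrite -big_split; apply: eq_bigr => i _; rewrite frobD. Qed.

Lemma trc0 t s : trc t s (0 : L) = 0.
Proof. by apply: big1 => i _; rewrite frob0. Qed.

Lemma trc_sum (I : Type) (r : seq I) (P : pred I) (F : I -> L) t s :
  trc t s (\sum_(j <- r | P j) F j) = \sum_(j <- r | P j) trc t s (F j).
Proof. exact: (big_morph _ (trcD t s) (trc0 t s)). Qed.

Lemma trcX t s i (y : L) : trc t s y ^+ (2 ^ i) = trc t s (y ^+ (2 ^ i)).
Proof.
by rewrite frob_sum; apply: eq_bigr => j _; rewrite !frob_comp addnC.
Qed.

(** Raising to the power [2 ^ s] permutes the conjugates of [y] cyclically. *)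
Lemma trc_frob1 t s (y : L) :
  y ^+ (2 ^ (s * t)) = y -> trc t s (y ^+ (2 ^ s)) = trc t s y.
Proof.
case: t => [|t] fix_y; first by rewrite /trc !big_ord0.
rewrite /trc big_ord_recr big_ord_recl /= addrC muln0 expn0 expr1.
rewrite frob_comp -mulnS fix_y; congr (_ + _).
by apply: eq_bigr => i _; rewrite frob_comp -mulnS.
Qed.

Lemma trc_frob t s i (y : L) :
  (s %| i)%N -> y ^+ (2 ^ (s * t)) = y -> trc t s (y ^+ (2 ^ i)) = trc t s y.
Proof.
move=> /dvdnP[q ->] fix_y; elim: q => [|q IH]; first by rewrite mul0n expr1.
rewrite mulSn addnC -frob_comp trc_frob1 //.
by rewrite frob_comp addnC -frob_comp fix_y.
Qed.

Lemma inSub_trc t s (y : L) : y ^+ (2 ^ (s * t)) = y -> inSub s (trc t s y).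
Proof. by move=> fix_y; rewrite /inSub trcX trc_frob1. Qed.

Lemma inSub0 s : inSub s (0 : L).
Proof. by rewrite /inSub frob0. Qed.

Lemma inSubD s (x y : L) : inSub s x -> inSub s y -> inSub s (x + y).
Proof. by rewrite /inSub frobD => /eqP-> /eqP->. Qed.

Lemma inSub_sum (I : Type) (r : seq I) (P : pred I) (F : I -> L) s :
  (forall j, P j -> inSub s (F j)) -> inSub s (\sum_(j <- r | P j) F j).
Proof. exact: (big_ind (fun x : L => inSub s x) (inSub0 s) (inSubD s)). Qed.

Lemma trc_trans s t (y : L) : trc s 1 (trc t s y) = trc (s * t) 1 y.
Proof.
elim: t => [|t IH]; first by rewrite muln0 /trc !big_ord0 -/(trc s 1 0) trc0.
rewrite [trc t.+1 s y]big_ord_recr /= -/(trc t s y) trcD IH mulnS addnC.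
rewrite /trc big_split_ord /=; congr (_ + _); apply: eq_bigr => i _ /=.
by rewrite frob_comp !mul1n.
Qed.

(** Transitivity through a quadratic extension; it turns the trace of the [a_0] term, taken from the
    field of [2 ^ n] elements, into a trace from [L]. *)
Lemma trc_double t s (y : L) :
  trc t s (y + y ^+ (2 ^ (s * t))) = trc (2 * t) s y.
Proof.
rewrite trcD /trc mul2n -addnn [RHS]big_split_ord /=; congr (_ + _).
by apply: eq_bigr => i _ /=; rewrite frob_comp -mulnDr.
Qed.

Lemma trc_nondegenerate t s (u : L) :
  m = (s * t)%N -> (forall y, trc t s (y * u) = 0) -> u = 0.
Proof.
move=> mE vanish; apply/eqP; apply: contraT => u_neq0.
have m_gt0 := card_exp_gt0.
have t_gt0 : (0 < t)%N by case: t mE m_gt0 {vanish} => //; rewrite muln0 => ->.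
have s_gt0 : (0 < s)%N by case: s mE m_gt0 {vanish} => // ->.
(* Dividing by [u] makes the trace vanish on all of [L]; it is a linearized polynomial with all
   coefficients 1, so independence would give 1 = 0. *)
suff /(_ (Ordinal t_gt0))/eqP : forall i : 'I_t, (1 : L) = 0 by rewrite oner_eq0.
apply: (@linearized_free 'I_t (fun i => s * i)%N (fun=> 1)) => [i j | x].
  rewrite !modn_small ?mE ?ltn_pmul2l // => /eqP.
  by rewrite eqn_pmul2l // => /eqP/ord_inj.
rewrite -[RHS](vanish (x / u)) divfK //.
by apply: eq_bigr => i _; rewrite mul1r.
Qed.

(** * The additive character and its Fourier sums *)

Lemma sgnF2D (x y : L) :
  inSub 1 x -> inSub 1 y -> sgnF2 (x + y) = sgnF2 x * sgnF2 y.
Proof.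
have F2 (z : L) : inSub 1 z -> z = 0 \/ z = 1.
  rewrite /inSub expr2 -subr_eq0 -{3}[z]mulr1 -mulrBr mulf_eq0 subr_eq0.
  by case/orP=> /eqP; [left | right].
move=> /F2[] -> /F2[] ->; rewrite /sgnF2 ?addr0 ?add0r ?eqxx ?mulr1 ?mul1r //.
by rewrite (addrr_pchar2 pchar2) eqxx oner_eq0.
Qed.

Lemma sqr_sgnF2 (x : L) : sgnF2 x ^+ 2 = 1.
Proof. by rewrite /sgnF2; case: ifP. Qed.

Lemma sgnF2_eq1 (x : L) : (sgnF2 x == 1) = (x == 0).
Proof. by rewrite /sgnF2; case: ifP. Qed.

Definition achar (x : L) : int := sgnF2 (trc m 1 x).

Lemma inSub_atrc (y : L) : inSub 1 (trc m 1 y).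
Proof. by rewrite inSub_trc // mul1n frob_full. Qed.

Lemma acharD x y : achar (x + y) = achar x * achar y.
Proof. by rewrite /achar trcD sgnF2D ?inSub_atrc. Qed.

Lemma achar_trivial u : (forall x, achar (x * u) = 1) -> u = 0.
Proof.
move=> u1; apply: (@trc_nondegenerate m 1); first by rewrite mul1n.
by move=> y; apply/eqP; rewrite -sgnF2_eq1 -/(achar _) u1.
Qed.

Lemma achar_orthogonal u :
  \sum_t achar (t * u) = if u == 0 then (2 ^ m)%:R else 0.
Proof.
have -> : \sum_t achar (t * u) = \sum_(t in [set: L]) achar (t * u).
  by apply: eq_bigl => t; rewrite inE.
rewrite sum_multiplicative => [|x y _ _|x y _ _]; first last.
- by rewrite mulrDl acharD.
- by rewrite inE.
rewrite cardsT cardL; congr (if _ then _ else _).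
apply/forall_inP/eqP => [u1 | -> x _].
  by apply: achar_trivial => x; apply/eqP/u1; rewrite inE.
by rewrite mulr0 /achar trc0 sgnF2_eq1.
Qed.

Lemma sum_fourier (f : L -> int) :
  \sum_t \sum_x f x * achar (t * x) = (2 ^ m)%:R * f 0.
Proof.
rewrite exchange_big (bigD1 0) //= [X in _ + X]big1 => [|x x_neq0].
  by rewrite -mulr_sumr achar_orthogonal eqxx addr0 mulrC.
by rewrite -mulr_sumr achar_orthogonal (negPf x_neq0) mulr0.
Qed.

(** Parseval: by orthogonality only pairs with [x + y = 0] survive, and in characteristic 2 these
    are the pairs with [x = y]. *)
Lemma sum_sqr_fourier (f : L -> int) :
    (forall x, f x ^+ 2 = 1) ->
  \sum_t (\sum_x f x * achar (t * x)) ^+ 2 = (2 ^ m)%:R ^+ 2.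
Proof.
move=> f2.
under eq_bigr => t _.
  rewrite expr2 big_distrl /=.
  under eq_bigr => x _.
    rewrite mulr_sumr.
    under eq_bigr => y _ do rewrite mulrACA -acharD -mulrDr.
    over.
  over.
rewrite exchange_big /=.
under eq_bigr => x _.
  rewrite exchange_big (bigD1 x) //= [X in _ + X]big1.
    rewrite -mulr_sumr -expr2 f2 (addrr_pchar2 pchar2) achar_orthogonal eqxx.
    rewrite mul1r addr0; over.
  move=> y yx; rewrite -mulr_sumr achar_orthogonal addr_eq0.
  by rewrite (oppr_pchar2 pchar2) eq_sym (negPf yx) mulr0.
by rewrite sumr_const cardL expr2 mulr_natl.
Qed.

End FiniteFieldOfChar2.

(** * Subsets stable under a subfield *)

(** For [u = q * s + r] the remainder of [2 ^ u - 1] is [2 ^ r - 1], which is smaller than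
    [2 ^ s - 1] and so divisible by it only for [r = 0]. *)
Lemma dvdn_pred_exp2 s u : (0 < s)%N -> ((2 ^ s).-1 %| (2 ^ u).-1)%N -> (s %| u)%N.
Proof.
move=> s_gt0; rewrite {1}(divn_eq u s) /dvdn.
set q := (u %/ s)%N; set r := (u %% s)%N => dvd.
have lt_rs : (r < s)%N by rewrite ltn_mod.
have split_pred : ((2 ^ (q * s + r)).-1 = 2 ^ r * (2 ^ (q * s)).-1 + (2 ^ r).-1)%N.
  have := expn_gt0 2 r; have := expn_gt0 2 (q * s); rewrite expnD /=.
  by nia.
move: dvd; rewrite split_pred -/(dvdn _ _) dvdn_addr; last first.
  by rewrite dvdn_mull // mulnC expnM dvdn_pred_predX.
move/dvdn_leq; have := expn_gt0 2 r; have : (2 ^ r < 2 ^ s)%N by rewrite ltn_exp2l.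
have [-> //|r_gt0] := posnP r; have := ltn_expl r (isT : 1 < 2)%N.
by lia.
Qed.

Section ScalarClosed.

Variables (L : finFieldType) (m s : nat) (pi : L) (W : {set L}).
Hypotheses (cardL : #|L| = (2 ^ m)%N) (s_gt0 : (0 < s)%N) (s_dvd_m : (s %| m)%N).
Hypothesis pi_prim : (#|L|.-1).-primitive_root pi.
Hypotheses (W0 : 0 \in W) (WZ : forall u x, inSub s u -> x \in W -> u * x \in W).

(* The nonzero elements of [W] split into the fibres of [x |-> x ^ (2^s - 1)],
   which are free orbits of the multiplicative group of the subfield. *)
Lemma card_scalar_closed_mod : ((2 ^ s).-1 %| #|W|.-1)%N.
Proof.
set q1 := (2 ^ s).-1.
have q1E : (2 ^ s = q1.+1)%N by rewrite prednK ?expn_gt0.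
have q1_gt0 : (0 < q1)%N by rewrite -ltnS -q1E -{1}(expn0 2) ltn_exp2l.
have [z z_prim] : {z : L | q1.-primitive_root z}.
  exists (pi ^+ (#|L|.-1 %/ q1)); apply: (dvdn_prim_root pi_prim).
  by rewrite cardL -(divnK s_dvd_m) mulnC expnM dvdn_pred_predX.
have zF i : inSub s (z ^+ i).
  by rewrite /inSub q1E exprS -exprM mulnC exprM (prim_expr_order z_prim) expr1n mulr1.
have -> : (#|W|.-1 = #|W :\ 0%R|)%N by rewrite (cardsD1 0%R W) W0.
rewrite -sum1_card (partition_big (fun x => x ^+ q1) xpredT) //=.
apply: dvdn_sum => y _; rewrite sum1dep_card.
set F := [set x | _].
have [-> | /set0Pn[x0]] := eqVneq F set0; first by rewrite cards0 dvdn0.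
rewrite !inE => /andP[/andP[x0_neq0 Wx0] /eqP x0y].
suff -> : F = [set z ^+ i * x0 | i : 'I_q1].
  rewrite card_imset ?card_ord // => i j /(mulIf x0_neq0)/eqP.
  rewrite (eq_prim_root_expr z_prim) !modn_small // => /eqP.
  exact: ord_inj.
apply/setP => x; apply/idP/imsetP => [|[i _ ->]].
  rewrite !inE => /andP[/andP[x_neq0 Wx] /eqP xy].
  have : (x / x0) ^+ q1 = 1 by rewrite expr_div_n xy x0y divff // -x0y expf_neq0.
  by case/(prim_rootP z_prim) => i zi; exists i; rewrite // -zi divfK.
rewrite !inE WZ // exprMn x0y -exprM mulnC exprM (prim_expr_order z_prim).
by rewrite expr1n mul1r eqxx !andbT mulf_neq0 ?expf_neq0 ?(prim_root_eq0 z_prim) -?lt0n.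
Qed.

(** No basis is chosen: the divisibility makes [#|W|] a power of 2, and the orbit count forces its
    exponent to be a multiple of [s]. *)
Lemma card_scalar_closed : (#|W| %| 2 ^ m)%N ->
  exists2 w, (w <= m %/ s)%N & #|W| = (2 ^ (s * w))%N.
Proof.
case/(@dvdn_pfactor 2 _ _ isT) => u le_um Wu.
have : (s %| u)%N.
  by apply: dvdn_pred_exp2; rewrite // -Wu; apply: card_scalar_closed_mod.
case/dvdnP => w uE; exists w; last by rewrite Wu uE mulnC.
by rewrite leq_divRL // -uE.
Qed.

End ScalarClosed.

(** * The forms Q_a *)

Section QuadraticForms.

Variables (L : finFieldType) (m n d e k : nat).
Hypotheses (e_gt0 : (0 < e)%N) (k_gt0 : (0 < k)%N).
Hypotheses (mE : m = (2 * n)%N) (eE : e = gcdn n d) (eE' : e = gcdn m d).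
Hypothesis k_le : (k <= n %/ e)%N.
Hypothesis cardL : #|L| = (2 ^ m)%N.

Implicit Type a : {ffun 'I_k.+1 -> L}.

Local Notation N := (n %/ e)%N.

(** * Arithmetic of the exponents *)

Lemma nE : n = (N * e)%N.
Proof. by rewrite divnK // eE dvdn_gcdl. Qed.

Lemma dE : d = (d %/ e * e)%N.
Proof. by rewrite divnK // eE dvdn_gcdr. Qed.

Lemma m_div_e : (m %/ e = 2 * N)%N.
Proof. by rewrite mE {1}nE mulnA mulnK. Qed.

Lemma m_eq_mul : m = (e * (m %/ e))%N.
Proof. by rewrite m_div_e mE {1}nE; ring. Qed.

Lemma muld_div_e : (n * d %/ e = N * d)%N.
Proof. by rewrite {1}nE -mulnA [(e * d)%N]mulnC mulnA mulnK. Qed.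

Lemma frob_e_full (x : L) : x ^+ (2 ^ (e * (m %/ e))) = x.
Proof. by rewrite -m_eq_mul (frob_full _ _ cardL). Qed.

Lemma coprime_ratio : coprime (2 * N) (d %/ e).
Proof.
have g_gt0 : (0 < gcdn m d)%N by rewrite -eE'.
have mE2 : m = (2 * N * e)%N by rewrite mE {1}nE mulnA.
rewrite /coprime -(eqn_pmul2r e_gt0) mul1n muln_gcdl -mE2 -dE.
by rewrite -eE'.
Qed.

Lemma e_dvd_muld i : (e %| i * d)%N.
Proof. by rewrite dE dvdn_mull // dvdn_mull. Qed.

(** After division by [e], the factor [d %/ e] is invertible modulo [m / e = 2 * N]. Hence the
    Frobenius powers with exponents [i * d], [i < 2 * N], are pairwise distinct. *)
Lemma eq_muld_mod i j :
  (i * d = j * d %[mod m])%N -> (i < 2 * N)%N -> (j < 2 * N)%N -> i = j.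
Proof.
have mE2 : m = (2 * N * e)%N by rewrite mE {1}nE mulnA.
wlog le_ji : i j / (j <= i)%N => [sym eq_ij lt_i lt_j|].
  by case: (leqP j i) => [|/ltnW] /sym; [apply | move=> H; apply/esym/H].
move/eqP; rewrite eqn_mod_dvd ?leq_mul2r ?le_ji ?orbT // -mulnBl dE mE2 mulnA.
rewrite dvdn_pmul2r // Gauss_dvdl ?coprime_ratio // => dvd lt_i lt_j.
apply/eqP; rewrite eqn_leq le_ji -subn_eq0 andbT.
by rewrite -[_ == _]negbK -lt0n; apply/negP => /dvdn_leq/(_ dvd); lia.
Qed.

(** Being coprime to [2 * N], the quotient [d %/ e] is odd, so [N * d = n * (d %/ e)] is congruent
    to [n] modulo [m = 2 * n]. *)
Lemma frob_half (x : L) : x ^+ (2 ^ (N * d)) = x ^+ (2 ^ n).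
Proof.
have odd_d : odd (d %/ e).
  have := coprime_ratio; rewrite coprimeMl => /andP[]; rewrite coprime2n.
  by [].
have -> : (N * d = m * (d %/ e)./2 + n)%N.
  have qE : (1 + (d %/ e)./2 * 2 = d %/ e)%N.
    by rewrite -[RHS]odd_double_half odd_d -muln2.
  by rewrite {1}dE mulnCA -nE -{1}qE mE; ring.
by rewrite -frob_comp (frob_full L m cardL (m * _)) ?dvdn_mulr.
Qed.

(** * Polarization of the forms *)

Definition polar_map a (x : L) : L :=
  a ord0 * x ^+ (2 ^ (N * d))
  + \sum_(1 <= j < k) (a (inord j) * x ^+ (2 ^ ((N - j) * d))
                       + (a (inord j) * x) ^+ (2 ^ ((N + j) * d))).

Lemma polar_mapD a x y : polar_map a (x + y) = polar_map a x + polar_map a y.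
Proof.
rewrite /polar_map (frobD _ _ cardL) mulrDr addrACA -big_split /=; congr (_ + _).
apply: eq_bigr => j _; rewrite mulrDr !(frobD _ _ cardL) mulrDr.
by rewrite addrACA.
Qed.

Lemma polar_mapZ a u x : inSub e u -> polar_map a (u * x) = u * polar_map a x.
Proof.
move=> /eqP fix_u; have uF i : u ^+ (2 ^ (i * d)) = u.
  by rewrite (frob_dvd_fix _ e) // e_dvd_muld.
rewrite /polar_map [RHS]mulrDr exprMn uF (mulrCA _ u) mulr_sumr.
congr (_ + _); apply: eq_bigr => j _.
by rewrite [RHS]mulrDr !exprMn !uF !(mulrCA _ u).
Qed.

Lemma polar_map_free a :
  (forall x, polar_map a x = 0) -> forall j : 'I_k.+1, (j < k)%N -> a j = 0.
Proof.
move=> pa0.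
set k' := k.-1; have kE : (k'.+1 = k)%N by rewrite prednK.
(* The left summand carries the multipliers [N - j] for [0 <= j < k], the right one [N + j] for
   [1 <= j < k], shifted by one. All are distinct and below [2 * N] because [k <= N]. *)
pose s (u : 'I_k'.+1 + 'I_k') : nat :=
  match u with inl j => (N - j) * d | inr j => (N + j.+1) * d end%N.
pose c (u : 'I_k'.+1 + 'I_k') : L :=
  match u with
  | inl j => a (inord j)
  | inr j => a (inord j.+1) ^+ (2 ^ ((N + j.+1) * d))
  end.
have c0 : forall u, c u = 0.
  apply: (@linearized_free L m cardL _ s) => [u v | x].
    have k_leN : (k'.+1 <= N)%N by rewrite kE.
    case: u v => [i|i] [j|j] /= /eq_muld_mod;
      have := ltn_ord i; have := ltn_ord j => lt_j lt_i ij;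
      first [congr inl; apply: ord_inj; lia | congr inr; apply: ord_inj; lia | lia].
  rewrite big_sumType /= big_ord_recl /= -[RHS](pa0 x) /polar_map.
  rewrite big_add1 big_mkord big_split /= subn0 addrA.
  have -> : inord 0 = ord0 :> 'I_k.+1 by apply: ord_inj; rewrite inordK.
  by congr (_ + _); apply: eq_bigr => j _; rewrite // exprMn.
move=> j j_lt; have lt_jk : (j < k'.+1)%N by rewrite kE.
by have := c0 (inl (Ordinal lt_jk)); rewrite /= inord_val.
Qed.

Lemma polarize_term s (b x y : L) : b * (x + y) ^+ (2 ^ s + 1) =
  b * x ^+ (2 ^ s + 1) + b * y ^+ (2 ^ s + 1)
  + (b * x ^+ (2 ^ s) * y + b * y ^+ (2 ^ s) * x).
Proof. by rewrite !addn1 !exprSr (frobD _ _ cardL); ring. Qed.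

(** Each monomial polarizes into two terms, linear in [y] and in [x] respectively. A Frobenius
    power, under which the trace is invariant, makes the second one linear in [y] too. *)
Lemma Bf_trace a x y :
  inSub n (a ord0) -> Bf m n d e a x y = trc (m %/ e) e (y * polar_map a x).
Proof.
move=> /eqP a0F.
have trcD' t s := @trcD L m cardL t s.
rewrite /polar_map mulrDr trcD' mulr_sumr (trc_sum _ _ cardL).
transitivity
  (trc N e (a ord0 * x ^+ (2 ^ (N * d)) * y + a ord0 * y ^+ (2 ^ (N * d)) * x)
   + \sum_(1 <= j < k) trc (m %/ e) e
       (a (inord j) * x ^+ (2 ^ ((N - j) * d)) * y
        + a (inord j) * y ^+ (2 ^ ((N - j) * d)) * x)).
  rewrite /Bf /Qf muld_div_e polarize_term mulrDr !trcD'.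
  under eq_bigr => j _ do rewrite polarize_term !trcD'.
  under [X in _ = _ + X]eq_bigr => j _ do rewrite trcD'.
  rewrite !big_split /=.
  by ring.
congr (_ + _).
  (* For the [a_0] monomial the second term is the conjugate of the first under the power [2 ^ n],
     which fixes [a_0]. *)
  rewrite m_div_e -(trc_double _ _ cardL); congr (trc _ _ (_ + _)); first by ring.
  have fix_nn : x ^+ (2 ^ (n + n)) = x.
    by rewrite (frob_full _ _ cardL) // mE mul2n addnn.
  rewrite !exprMn [(e * N)%N]mulnC -nE a0F !frob_half frob_comp fix_nn.
  by rewrite -mulrA mulrCA.
apply: eq_big_nat => j /andP[_ lt_jk]; rewrite mulrDr !trcD'.
congr (_ + _); first by congr trc; ring.
(* The exponent [(N + j) * d] complements [(N - j) * d] to [2 * N * d], a multiple of [m], so [y]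
   returns to the first power. *)
rewrite -(trc_frob L _ e ((N + j) * d)%N) ?e_dvd_muld ?frob_e_full //.
congr trc; rewrite !exprMn frob_comp -mulnDl.
have -> : (N - j + (N + j) = 2 * N)%N by move: k_le; lia.
rewrite [y ^+ _](frob_full _ _ cardL); last first.
  by rewrite mE {1}nE mulnA dvdn_mul // eE dvdn_gcdr.
by rewrite mulrAC mulrC.
Qed.

(** * Values and additivity of the forms *)

Lemma ord_max_eq (j : 'I_k.+1) : (k <= j)%N -> j = ord_max.
Proof.
by move=> le_kj; apply: ord_inj; apply/eqP; rewrite eqn_leq le_kj -ltnS ltn_ord.
Qed.

Lemma domE a : (a \in dom L n k) = inSub n (a ord0).
Proof. by rewrite inE. Qed.

Lemma inord_lt (j : nat) : (j < k)%N -> (inord j == ord_max :> 'I_k.+1) = false.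
Proof.
move=> lt_jk; apply/negP => /eqP/(congr1 val) /=.
by rewrite inordK ?ltnS ?(ltnW lt_jk) // => jk; rewrite jk ltnn in lt_jk.
Qed.

Lemma inSub_Qf a x : a \in dom L n k -> inSub e (Qf m n d e a x).
Proof.
rewrite domE => /eqP a0F; rewrite /Qf; apply: inSubD cardL _ _ _ _ _.
  apply: (inSubD _ _ cardL).
    apply: (inSub_trc _ _ cardL); rewrite muld_div_e [(e * N)%N]mulnC -nE.
    (* Here [x ^+ (2 ^ n) * x] is the norm of [x] to the field of [2 ^ n] elements. *)
    rewrite !exprMn a0F exprD expr1 frob_half exprMn frob_comp addnn -mul2n -mE.
    by rewrite (frob_full _ _ cardL) // [x * _]mulrC.
  by apply: (inSub_sum _ _ cardL) => j _;
    apply: (inSub_trc _ _ cardL); rewrite frob_e_full.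
by apply: (inSub_trc _ _ cardL); rewrite frob_e_full.
Qed.

Lemma QfD a b x : Qf m n d e (a + b) x = Qf m n d e a x + Qf m n d e b x.
Proof.
rewrite /Qf !ffunE !mulrDl !(trcD _ _ cardL) [RHS]addrACA; congr (_ + _).
rewrite [RHS]addrACA; congr (_ + _); rewrite -big_split; apply: eq_bigr => j _.
by rewrite ffunE mulrDl (trcD _ _ cardL).
Qed.

Lemma Qf0 a : Qf m n d e a 0 = 0.
Proof.
rewrite /Qf !addn1 exprS mul0r !mulr0 !trc0 addr0 add0r.
by apply: big1 => j _; rewrite addn1 exprS mul0r mulr0 trc0.
Qed.

Lemma Qf_linear a x : (forall j : 'I_k.+1, (j < k)%N -> a j = 0) ->
  Qf m n d e a x = trc (m %/ e) e (a ord_max * x).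
Proof.
move=> a0; rewrite /Qf a0 // mul0r trc0 add0r big1_seq ?add0r //.
move=> j /andP[_]; rewrite mem_index_iota => /andP[_ lt_jk].
by rewrite a0 ?mul0r ?trc0 // inordK // ltnS ltnW.
Qed.

(** * Signs and exponential sums *)

Definition qsgn a (x : L) : int := sgnF2 (trc e 1 (Qf m n d e a x)).

Lemma atrc_trans (y : L) : trc e 1 (trc (m %/ e) e y) = trc m 1 y.
Proof. by rewrite (trc_trans _ _ cardL) -m_eq_mul. Qed.

Lemma inSub1_Qf a x : a \in dom L n k -> inSub 1 (trc e 1 (Qf m n d e a x)).
Proof.
by move=> /(inSub_Qf a x)/eqP QF; apply: (inSub_trc _ _ cardL); rewrite mul1n.
Qed.

Lemma qsgnD a x y : a \in dom L n k ->
  qsgn a (x + y) = qsgn a x * qsgn a y * achar L m (x * polar_map a y).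
Proof.
move=> a_dom; rewrite /qsgn.
have -> : Qf m n d e a (x + y) =
    Qf m n d e a x + Qf m n d e a y + trc (m %/ e) e (x * polar_map a y).
  by rewrite -Bf_trace -?domE // /Bf addrC [y + x]addrC; ring.
rewrite (trcD _ _ cardL _ _ (_ + _) (trc _ _ _)) (trcD _ _ cardL _ _ (Qf _ _ _ _ _ _)).
rewrite atrc_trans.
by rewrite !(sgnF2D _ _ cardL) ?(inSubD _ _ cardL) ?inSub1_Qf ?(inSub_atrc _ _ cardL).
Qed.

Lemma qsgn0 a : qsgn a 0 = 1.
Proof. by rewrite /qsgn Qf0 trc0 /sgnF2 eqxx. Qed.

(** Constant signs make every character value [achar L m (x * polar_map a y)] trivial, which kills
    all [a_j] with [j < k]; the remaining linear form then forces [a_k = 0]. *)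
Lemma trc_Qf_eq0 a : a \in dom L n k ->
  (forall x, trc e 1 (Qf m n d e a x) = 0) -> a = 0.
Proof.
move=> a_dom Q0; have q1 x : qsgn a x = 1 by rewrite /qsgn Q0 /sgnF2 eqxx.
have a0 : forall j : 'I_k.+1, (j < k)%N -> a j = 0.
  apply: polar_map_free => y; apply: (achar_trivial _ _ cardL) => x.
  by have := qsgnD a x y a_dom; rewrite !q1 !mul1r.
apply/ffunP => j; rewrite ffunE.
have [/a0 // | le_kj] := ltnP j k.
rewrite (ord_max_eq _ le_kj).
apply: (achar_trivial _ _ cardL) => x.
by rewrite /achar -atrc_trans mulrC -Qf_linear // -/(qsgn _ _) q1.
Qed.

Lemma radicalE a : a \in dom L n k ->
  radical m n d e a = [set x | polar_map a x == 0].
Proof.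
rewrite domE => a_dom; apply/setP => x; rewrite !inE.
apply/forallP/eqP => [B0 | px0 y]; last first.
  by rewrite Bf_trace // px0 mulr0 trc0.
apply: (trc_nondegenerate _ _ cardL _ _ _ m_eq_mul) => y.
by rewrite -Bf_trace // (eqP (B0 y)).
Qed.

Definition expsum a : int := \sum_x qsgn a x.

Lemma sqr_expsum a : a \in dom L n k ->
  expsum a ^+ 2 = 0 \/ expsum a ^+ 2 = 2 ^+ m * #|radical m n d e a|%:R.
Proof.
move=> a_dom.
have := @sqr_quadratic_sum L (qsgn a) (fun x y => achar L m (x * polar_map a y)).
rewrite cardL natrX radicalE //.
have -> : [set y | [forall x, achar L m (x * polar_map a y) == 1]]
    = [set x | polar_map a x == 0].
  apply/setP => y; rewrite !inE; apply/forallP/eqP => [c1 | -> x].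
    by apply: (achar_trivial _ _ cardL) => x; apply/eqP.
  by rewrite mulr0 /achar trc0 /sgnF2 eqxx.
apply=> [x | x y | x x' y | x y y']; first exact: sqr_sgnF2.
- exact: qsgnD.
- by rewrite mulrDl (acharD _ _ cardL).
- by rewrite polar_mapD mulrDr (acharD _ _ cardL).
Qed.

(** * Translation of the last coefficient *)

Definition shift a (t : L) : {ffun 'I_k.+1 -> L} :=
  [ffun i => if i == ord_max then a i + t else a i].

Lemma shift_lt a t (j : 'I_k.+1) : (j < k)%N -> shift a t j = a j.
Proof. by move=> lt_jk; rewrite ffunE -[j]inord_val inord_lt. Qed.

Lemma shift_dom a t : (shift a t \in dom L n k) = (a \in dom L n k).
Proof. by rewrite !domE shift_lt. Qed.

Lemma shift_inj t : injective (shift^~ t).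
Proof.
move=> a b /ffunP ab; apply/ffunP => i; have := ab i.
by rewrite !ffunE; case: ifP => // _ /addIr.
Qed.

Lemma polar_map_shift a t x : polar_map (shift a t) x = polar_map a x.
Proof.
rewrite /polar_map shift_lt //; congr (_ + _); apply: eq_big_nat => j /andP[_ lt_jk].
by rewrite !shift_lt // inordK // ltnS ltnW.
Qed.

Lemma radical_shift a t : a \in dom L n k ->
  radical m n d e (shift a t) = radical m n d e a.
Proof.
move=> a_dom; rewrite !radicalE ?shift_dom //.
by apply/setP => x; rewrite !inE polar_map_shift.
Qed.

Lemma expsum_shift a t : a \in dom L n k ->
  expsum (shift a t) = \sum_x qsgn a x * achar L m (t * x).
Proof.
move=> a_dom; apply: eq_bigr => x _; rewrite /qsgn /achar -atrc_trans.
rewrite -(sgnF2D _ _ cardL) ?inSub1_Qf //; last first.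
  by rewrite atrc_trans (inSub_atrc _ _ cardL).
rewrite -(trcD _ _ cardL); congr (sgnF2 (trc _ _ _)).
rewrite /Qf shift_lt // [shift _ _ ord_max]ffunE eqxx mulrDl (trcD _ _ cardL) !addrA.
congr (_ + _ + _ + _); apply: eq_big_nat => j /andP[_ lt_jk].
by rewrite !shift_lt // inordK // ltnS ltnW.
Qed.

Lemma sum_expsum_shift a : a \in dom L n k -> \sum_t expsum (shift a t) = 2 ^+ m.
Proof.
move=> a_dom; under eq_bigr => t _ do rewrite expsum_shift //.
by rewrite (sum_fourier _ _ cardL) qsgn0 mulr1 natrX.
Qed.

Lemma sum_sqr_expsum_shift a : a \in dom L n k ->
  \sum_t expsum (shift a t) ^+ 2 = (2 ^+ m) ^+ 2.
Proof.
move=> a_dom; under eq_bigr => t _ do rewrite expsum_shift //.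
rewrite (sum_sqr_fourier _ _ cardL) ?natrX // => x.
exact: sqr_sgnF2.
Qed.

(** All shifts of [a] have the same radical, so each squared sum is 0 or [2 ^ m * R]. Their total is
    [2 ^ (2 * m)] by Parseval, hence [R] times the number of shifts attaining [2 ^ m * R] is
    [2 ^ m]. *)
Lemma card_radical_dvd a : a \in dom L n k -> (#|radical m n d e a| %| 2 ^ m)%N.
Proof.
move=> a_dom; set R := #|_|.
pose T := [set t | expsum (shift a t) ^+ 2 == 2 ^+ m * R%:R].
have : \sum_t expsum (shift a t) ^+ 2 = (2 ^+ m * R%:R) *+ #|T|.
  rewrite -sumr_const [RHS]big_mkcond; apply: eq_bigr => t _.
  rewrite inE; case: eqP => // not_max.
  have := sqr_expsum (shift a t); rewrite shift_dom radical_shift //.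
  by case/(_ a_dom).
rewrite sum_sqr_expsum_shift // -!natrX -natrM -mulrnA => /eqP.
rewrite Num.Theory.eqr_nat expnS expn1 -mulnA eqn_pmul2l ?expn_gt0 // => /eqP ->.
exact: dvdn_mulr.
Qed.

(** * Rank and the values of the sums *)

Variable pi : L.
Hypothesis pi_prim : (#|L|.-1).-primitive_root pi.

(** The truncated logarithm and subtraction in [rk] are exact: the radical is stable under the
    subfield, so its cardinality is a power of [2 ^ e] dividing [2 ^ m]. *)
Lemma card_radical a : a \in dom L n k ->
  (rk m n d e a <= m %/ e)%N /\ #|radical m n d e a| = (2 ^ (m - e * rk m n d e a))%N.
Proof.
move=> a_dom; have e_dvd_m : (e %| m)%N by rewrite eE' dvdn_gcdl.
have [|u x | w le_w cardR] := @card_scalar_closed L m e pi (radical m n d e a)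
    cardL e_gt0 e_dvd_m pi_prim _ _ (card_radical_dvd _ a_dom).
- by rewrite radicalE // inE -(mul0r 0) polar_mapZ ?inSub0 ?mul0r.
- by move=> uF; rewrite radicalE // !inE polar_mapZ // => /eqP ->; rewrite mulr0.
rewrite /rk cardR expnM trunc_expnK ?(ltn_exp2l 0) // leq_subr; split=> //.
by rewrite {1}m_eq_mul -mulnBr subKn // expnM.
Qed.

Lemma expsum_values a : a \in dom L n k ->
  expsum a = 0 \/ expsum a ^+ 2 = 2 ^+ (2 * m - e * rk m n d e a).
Proof.
move=> a_dom; have [le_rk cardR] := card_radical _ a_dom.
have [/eqP | ->] := sqr_expsum _ a_dom; first by rewrite sqrf_eq0 => /eqP; left.
right; rewrite cardR natrX -exprD addnBA ?mul2n ?addnn //.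
by rewrite {2}m_eq_mul leq_mul2l le_rk orbT.
Qed.

Lemma sqr_half_power r : ~~ odd r ->
  (2 ^+ (m - e * r./2)) ^+ 2 = 2 ^+ (2 * m - e * r) :> int.
Proof.
move=> r_even; rewrite -exprM; congr (_ ^+ _).
rewrite -{2}(even_halfK r_even) -muln2.
by rewrite mulnBl mulnA [(m * 2)%N]mulnC.
Qed.

(** The rank is constant along the shifts of [a], so a single [P] serves for all of them in
    [count_three_valued], with [A = 2 ^ m]. *)
Lemma count_expsum_shift a r (eps : int) :
    a \in dom L n k -> ~~ odd r -> (r <= m %/ e)%N -> eps ^+ 2 = 1 ->
    rk m n d e a = r ->
  2 * 2 ^+ (2 * m - e * r)
    * #|[set t | expsum (shift a t) == eps * 2 ^+ (m - e * r./2)]|%:R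
  = (2 ^+ m) ^+ 2 + eps * 2 ^+ (m - e * r./2) * 2 ^+ m :> int.
Proof.
move=> a_dom r_even r_le eps2 rk_a; rewrite -sqr_half_power //.
apply: count_three_valued => // [t||]; last 2 first.
- exact: sum_expsum_shift.
- exact: sum_sqr_expsum_shift.
rewrite sqr_half_power // -rk_a.
have := expsum_values (shift a t); rewrite shift_dom /rk radical_shift //.
exact.
Qed.

(** * Codewords *)

Lemma neq0_prim_power (x : L) : x != 0 -> exists i : 'I_(2 ^ m - 1), x = pi ^- i.
Proof.
move=> x_neq0; have : x^-1 ^+ #|L|.-1 = 1.
  apply: (mulfI (invr_neq0 x_neq0)); rewrite -exprS mulr1.
  by rewrite prednK ?expf_card // cardL expn_gt0.
case/(prim_rootP pi_prim) => i xi.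
have lt_i : (i < 2 ^ m - 1)%N by rewrite subn1 -cardL.
by exists (Ordinal lt_i); rewrite /= -xi invrK.
Qed.

Lemma sum_power_prim (f : L -> int) :
  \sum_(i < 2 ^ m - 1) f (pi ^- i) = \sum_(x | x != 0) f x.
Proof.
have pi_neq0 i : pi ^- i != 0.
  rewrite invr_eq0 expf_neq0 // (prim_root_eq0 pi_prim) -lt0n.
  exact: prim_order_gt0 pi_prim.
have pi_inj : injective (fun i : 'I_(2 ^ m - 1) => pi ^- i).
  move=> i j /invr_inj/eqP; rewrite (eq_prim_root_expr pi_prim) cardL -subn1.
  by rewrite !modn_small // => /eqP/ord_inj.
rewrite -(big_imset f (in2W pi_inj)); apply: eq_bigl => x /=.
apply/imsetP/idP => [[i _ ->] // | /neq0_prim_power[i ->]].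
by exists i.
Qed.

Lemma DC_cw a : DC (cw m n d e pi a) = expsum a - 1.
Proof.
rewrite /DC; under eq_bigr => i _ do rewrite ffunE.
rewrite (sum_power_prim (qsgn a)) /expsum [in RHS](bigD1 0) //= qsgn0.
by rewrite [1 + _]addrC addrK.
Qed.

Lemma cw_inj : {in dom L n k &, injective (cw m n d e pi)}.
Proof.
move=> a b a_dom b_dom ab.
have eq_tr x : trc e 1 (Qf m n d e a x) = trc e 1 (Qf m n d e b x).
  have [-> | x_neq0] := eqVneq x 0; first by rewrite !Qf0.
  have [i ->] := neq0_prim_power _ x_neq0.
  by have := congr1 (fun c : {ffun 'I_(2 ^ m - 1) -> L} => c i) ab; rewrite !ffunE.
apply/eqP; rewrite -subr_eq0; apply/eqP; apply: trc_Qf_eq0 => [|x].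
  rewrite domE /inSub !ffunE -(oppr_pchar2 (pchar2 _ _ cardL) (b ord0)) opprK.
  by apply: (inSubD _ _ cardL); rewrite -domE.
have := eq_tr x; rewrite -{1}[a](subrK b) QfD (trcD _ _ cardL).
by rewrite -{2}[trc e 1 (Qf _ _ _ _ b x)]add0r => /addIr.
Qed.

Lemma cw0 : cw m n d e pi (0 : {ffun 'I_k.+1 -> L}) = [ffun=> 0].
Proof.
apply/ffunP => i; rewrite !ffunE Qf_linear => [|j _]; rewrite ffunE //.
by rewrite mul0r !trc0.
Qed.

Lemma dom0 : 0 \in dom L n k.
Proof. by rewrite domE ffunE inSub0. Qed.

Lemma cw_eq0 a : a \in dom L n k -> (cw m n d e pi a == [ffun=> 0]) = (a == 0).
Proof.
by move=> a_dom; rewrite -cw0; apply/eqP/eqP => [/cw_inj -> | ->] //; apply: dom0.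
Qed.

(** The sum of a nontrivial additive character; this keeps the nonzero codewords coming from [a_k]
    alone out of [alpha]. *)
Lemma expsum_linear a : (forall j : 'I_k.+1, (j < k)%N -> a j = 0) ->
  a != 0 -> expsum a = 0.
Proof.
move=> a0 a_neq0.
have amax : a ord_max != 0.
  apply: contraNneq a_neq0 => amax; apply/eqP/ffunP => j; rewrite ffunE.
  have [/a0 // | le_kj] := ltnP j k.
  by rewrite (ord_max_eq _ le_kj).
transitivity (\sum_x achar L m (x * a ord_max)).
  apply: eq_bigr => x _; rewrite /qsgn Qf_linear //.
  by rewrite atrc_trans [a _ * x]mulrC.
by rewrite (achar_orthogonal _ _ cardL) (negPf amax).
Qed.

(** * Double counting of parameters and shifts *)

Section Count.

Variables (r : nat) (eps : int).
Hypotheses (r_even : ~~ odd r) (r_le : (r <= m %/ e)%N) (eps2 : eps ^+ 2 = 1).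

Local Notation P := (2 ^+ (m - e * r./2) : int).

Let mixed a := [exists j : 'I_k.+1, (j < k)%N && (a j != 0)].

Let G := [set a in dom L n k | (rk m n d e a == r) && mixed a].

(** The value [eps * P] is nonzero, so its square determines the rank, and [expsum_linear] excludes
    a nonzero [a] concentrated on [a_k]. *)
Lemma cw_counted a : a \in dom L n k ->
  (cw m n d e pi a != [ffun=> 0]) && (DC (cw m n d e pi a) == -1 + eps * P)
  = (a \in G) && (expsum a == eps * P).
Proof.
move=> a_dom; rewrite cw_eq0 // DC_cw addrC (inj_eq (addrI _)) inE a_dom /=.
have [sum_a | _] := eqVneq (expsum a) (eps * P); rewrite ?andbF // !andbT.
have P_neq0 : P != 0 by rewrite expf_neq0.
have sum2 : expsum a ^+ 2 = 2 ^+ (2 * m - e * r).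
  by rewrite sum_a exprMn eps2 mul1r sqr_half_power.
have sum_neq0 : expsum a != 0 by rewrite -sqrf_eq0 sum2 expf_neq0.
have [a0 | a_neq0] := eqVneq a 0.
  apply/esym/negP => /andP[_ /existsP[j /andP[_]]].
  by rewrite a0 ffunE eqxx.
have -> : rk m n d e a == r.
  have [le_rk _] := card_radical _ a_dom.
  have [/eqP | ] := expsum_values _ a_dom; first by rewrite (negPf sum_neq0).
  rewrite sum2 => /eqP; rewrite -!natrX Num.Theory.eqr_nat eqn_exp2l // => /eqP eq_exp.
  (* Both [e * r] and [e] times the rank are at most [m], so neither subtraction from [2 * m]
     truncates and equal exponents give equal ranks. *)
  have := m_eq_mul; have : (e * r <= e * (m %/ e))%N by rewrite leq_mul2l r_le orbT.
  have : (e * rk m n d e a <= e * (m %/ e))%N by rewrite leq_mul2l le_rk orbT.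
  move=> le1 le2 mEq; rewrite -(eqn_pmul2l e_gt0); apply/eqP.
  by move: eq_exp le1 le2; rewrite -mEq; lia.
apply/esym; apply: contraNT sum_neq0 => /existsPn no_j; apply/eqP.
apply: expsum_linear => // j lt_jk; apply/eqP.
by have := no_j j; rewrite lt_jk negbK.
Qed.

Lemma alphaE : alpha m n d e k pi r eps = #|[set a in G | expsum a == eps * P]|.
Proof.
rewrite /alpha -(card_in_imset (f := cw m n d e pi)); last first.
  move=> a b; rewrite !inE => /andP[/andP[a_dom _] _] /andP[/andP[b_dom _] _].
  by apply: cw_inj; rewrite inE.
apply: eq_card => c; apply/idP/imsetP => [|[a aS ->]].
  rewrite inE => /andP[/imsetP[a a_dom ->]]; rewrite cw_counted // => counted.
  by exists a; rewrite // inE.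
case/setIdP: aS => aG sum_a.
have a_dom : a \in dom L n k by move: aG; rewrite inE => /andP[].
by rewrite inE cw_counted // aG sum_a imset_f.
Qed.

Lemma shift_G a t : (shift a t \in G) = (a \in G).
Proof.
rewrite !inE !shift_lt //; have [a0F | ] := boolP (inSub n (a ord0)) => //=.
rewrite /rk radical_shift ?domE //; congr (_ && _).
by apply: eq_existsb => j; case: ltnP => // lt_jk; rewrite shift_lt.
Qed.

(** Pairs [(a, t)] with [expsum (shift a t) = eps * P] are counted in two ways: for fixed [t], the
    shift permutes [G]. *)
Lemma count_shift :
  (2 ^ m * #|[set a in G | (expsum a == eps * P)%R]|
   = \sum_(a in G) #|[set t | (expsum (shift a t) == eps * P)%R]|)%N.
Proof.
under [RHS]eq_bigr => a _ do rewrite -sum1dep_card.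
under [RHS]eq_bigr => a _ do rewrite big_mkcond.
rewrite exchange_big /= -cardL -sum_nat_const; apply: eq_bigr => t _.
rewrite -sum1dep_card big_mkcondr.
rewrite (reindex_inj (shift_inj t)) /=; apply: eq_big => // a.
by rewrite shift_G.
Qed.

Lemma alpha_beta :
  2 * 2 ^+ (2 * m - e * r) * (2 ^ m * alpha m n d e k pi r eps)%:R
  = (beta_num L m n d e k r)%:R * ((2 ^+ m) ^+ 2 + eps * P * 2 ^+ m) :> int.
Proof.
rewrite alphaE count_shift natr_sum mulr_sumr.
under eq_bigr => a.
  rewrite inE => /andP[a_dom /andP[/eqP rk_a _]].
  rewrite count_expsum_shift //; over.
by rewrite sumr_const [RHS]mulr_natl.
Qed.

End Count.

End QuadraticForms.

(** * Normalization over the rationals *)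

Theorem theorem8p1 (L : finFieldType) (m n d e k : nat) (pi : L) :
  (0 < m)%N -> (0 < n)%N -> (0 < d)%N -> (0 < e)%N -> (0 < k)%N ->
  m = (2 * n)%N -> e = gcdn n d -> e = gcdn m d ->
  (1 <= k <= n %/ e)%N ->
  #|L| = (2 ^ m)%N ->
  (#|L|.-1).-primitive_root pi ->
  forall (r : nat) (eps : int),
    ~~ odd r -> (r <= m %/ e)%N -> (eps = 1 \/ eps = -1) ->
    (alpha m n d e k pi r eps)%:R =
      (1 / 2 : rat) * (2 ^+ (e * r) + eps%:~R * 2 ^+ (e * r./2))
      * ((beta_num L m n d e k r)%:R / 2 ^+ m).
Proof.
move=> _ _ _ e_gt0 k_gt0 mE eE eE' /andP[_ k_le] cardL pi_prim r eps r_even r_le eps1.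
have eps2 : eps ^+ 2 = 1 by case: eps1 => ->.
have := alpha_beta _ _ _ _ _ _ e_gt0 k_gt0 mE eE eE' k_le cardL _ pi_prim _ _
  r_even r_le eps2.
rewrite natrM natrX => /(congr1 (fun z : int => z%:~R : rat)).
have le_erm : (e * r <= m)%N.
  by rewrite (leq_trans _ (leq_divM m e)) // mulnC leq_mul2r r_le orbT.
have le_half : (e * r./2 <= m)%N.
  by rewrite (leq_trans _ le_erm) // leq_mul2l -{2}(odd_double_half r); lia.
have -> : (2 * m - e * r = (m - e * r./2) + (m - e * r./2))%N.
  have : (e * r = 2 * (e * r./2))%N by rewrite -{1}(even_halfK r_even); lia.
  by lia.
have -> : (e * r = e * r./2 + e * r./2)%N.
  by rewrite -{1}(even_halfK r_even) -addnn mulnDr.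
rewrite !(rmorphM, rmorphD, rmorphXn, rmorph_nat) /=.
move: (alpha _ _ _ _ _ _ _ _)%:R (beta_num _ _ _ _ _ _ _)%:R => A B.
(* With [p = 2 ^ (m - e * r./2)] and [q = 2 ^ (e * r./2)] one has [2 ^ m = p * q] and
   [2 ^ (e * r) = q * q], so the claim becomes a field identity in [p] and [q]. *)
have -> : m = (m - e * r./2 + e * r./2)%N by rewrite subnK.
rewrite addnK !exprD.
have := expf_neq0 (m - e * r./2) (isT : (2 : rat) != 0).
have := expf_neq0 (e * r./2) (isT : (2 : rat) != 0).
move: (2 ^+ (m - e * r./2)) (2 ^+ (e * r./2)) (eps%:~R) => p q E q_neq0 p_neq0 eqAB.
have pq_neq0 : 2 * (p * p) * (p * q) != 0 by rewrite !mulf_neq0.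
apply: (mulfI pq_neq0); rewrite -[LHS]mulrA eqAB.
by field; rewrite p_neq0 q_neq0.
Qed.
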